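(* Let $\widehat{A}=A+\varepsilon B$ be an $n\times n$ dual matrix with $A,B\in\mathbb{R}^{n\times n}$ and $\mathrm{rank}(A)=r$. Then the dual index of $\widehat{A}$ is one if and only if $\mathrm{Ind}(A)=1$ and $(I_n-AA^{\#})B(I_n-AA^{\#})=0$.
   Context: Dual numbers are $a+\varepsilon a'$ with $a,a'\in\mathbb{R}$ and $\varepsilon\neq 0$, $\varepsilon^2=0$ (i.e. the ring $\mathbb{R}[\varepsilon]/(\varepsilon^2)$). A dual matrix is a matrix over dual numbers, written $\widehat{A}=A+\varepsilon B$ with $A,B$ real. The range $\mathcal{R}(\widehat{A})$ of an $n\times n$ dual matrix is $\{\widehat{A}\widehat{x}: \widehat{x}$ a dual column vector of length $n\}$. The dual index of an $n\times n$ dual matrix $\widehat{A}$ is said to be equal to one if $\mathcal{R}(\widehat{A}^2)=\mathcal{R}(\widehat{A})$. For a real square matrix $A$, ''$\mathrm{Ind}(A)=1$'' means $\mathrm{rank}(A^2)=\mathrm{rank}(A)$; in that case $A^{\#}$ denotes the group inverse of $A$, i.e. the unique real $X$ with $AXA=A$, $XAX=X$, $AX=XA$. *)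

(* Defs.v *)
From HB Require Import structures.
From mathcomp Require Import all_boot all_order all_algebra qpoly.
From mathcomp Require Import boolp classical_sets reals.

Set Implicit Arguments.
Unset Strict Implicit.
Unset Printing Implicit Defensive.

Import GRing.Theory.
Local Open Scope classical_set_scope.
Local Open Scope ring_scope.

(* R[eps]/(eps^2).  A notation rather than a definition, so that the ring      *)
(* structure of {poly %/ h} is inferred.                                      *)
Notation dual R := {poly %/ ('X^2 : {poly R})}.

Definition eps (R : comNzRingType) : dual R := qpolyX 'X^2.
Arguments eps {R}.

Definition dualC (R : comNzRingType) (a : R) : dual R := qpolyC 'X^2 a.

(* A + eps B *)
Definition dualmx (R : comNzRingType) (m n : nat) (A B : 'M[R]_(m, n)) :
    'M[dual R]_(m, n) :=
  map_mx (@dualC R) A + eps *: map_mx (@dualC R) B.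

Definition dual_range (R : comNzRingType) (n : nat) (M : 'M[dual R]_n) :
    set 'cV[dual R]_n :=
  [set M *m x | x in [set: 'cV[dual R]_n]].

Definition dual_index_one (R : comNzRingType) (n : nat) (M : 'M[dual R]_n) :
    Prop :=
  dual_range (M ^+ 2) = dual_range M.

Definition index_one (R : fieldType) (n : nat) (A : 'M[R]_n) : Prop :=
  \rank (A ^+ 2) = \rank A.

Definition is_group_inverse (R : fieldType) (n : nat) (A X : 'M[R]_n) : Prop :=
  [/\ A *m X *m A = A, X *m A *m X = X & A *m X = X *m A].

(* The group inverse when it exists, and 0 otherwise; see group_inverseP and   *)
(* is_group_inverse_uniq.                                                     *)
Definition group_inverse (R : fieldType) (n : nat) (A : 'M[R]_n) : 'M[R]_n :=
  xget 0 [set X | is_group_inverse A X].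

Lemma val_eps (R : comNzRingType) : val (eps : dual R) = 'X.
Proof. by apply: qpolyXE; rewrite ?size_polyXn ?monicXn. Qed.

Lemma eps_neq0 (R : comNzRingType) : eps != 0 :> dual R.
Proof. by rewrite -val_eqE val_eps polyX_eq0. Qed.

Lemma eps_sqr (R : comNzRingType) : eps ^+ 2 = 0 :> dual R.
Proof.
apply: val_inj; rewrite [LHS]poly_of_qpolyX -[polyn _]/(val _) val_eps.
transitivity (0 : {poly R}) => //.
by rewrite mk_monic_Xn Pdiv.RingMonic.rmodpp ?monicXn.
Qed.

Lemma is_group_inverse_uniq (R : fieldType) (n : nat) (A X Y : 'M[R]_n) :
  is_group_inverse A X -> is_group_inverse A Y -> X = Y.
Proof.
move=> [AXA XAX AX] [AYA YAY AY].
have E : A *m X = A *m Y.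
  by rewrite AX -{1}AYA -mulmxA -AY !mulmxA -AX AXA.
by rewrite -XAX -mulmxA E mulmxA -AX E AY YAY.
Qed.

Lemma group_inverseP (R : fieldType) (n : nat) (A : 'M[R]_n) :
  index_one A -> is_group_inverse A (group_inverse A).
Proof.
rewrite /index_one expr2 -[A * A]/(A *m A) => rkA.
have /submxP[Y AY] : (A <= A *m A)%MS.
  by have [_ <-] := mxrank_leqif_sup (submxMl A A); rewrite rkA.
have /submxP[Z' AZ'] : (A^T <= A^T *m A^T)%MS.
  have [_ <-] := mxrank_leqif_sup (submxMl A^T A^T).
  by rewrite -trmx_mul !mxrank_tr rkA.
pose Z := Z'^T.
have AZ : A = A *m A *m Z.
  by apply: trmx_inj; rewrite !trmx_mul /Z trmxK.
have YA : Y *m A = A *m Z by rewrite {1}AZ !mulmxA -(mulmxA Y) -AY.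
apply: (@xgetPex _ 0 [set X | is_group_inverse A X]).
exists (Y *m A *m Z).
have AX : A *m (Y *m A *m Z) = A *m Z by rewrite YA !mulmxA -AZ.
have XA : Y *m A *m Z *m A = A *m Z.
  by rewrite -(mulmxA Y) -YA -!mulmxA -AY YA.
split.
- by rewrite AX -YA -mulmxA -AY.
- by rewrite XA -{1}YA -(mulmxA Y A (_ *m Z)) AX mulmxA.
- by rewrite AX XA.
Qed.

(* Main.v *)
Require Import Defs.
From mathcomp Require Import all_boot all_order all_algebra qpoly.
From mathcomp Require Import boolp classical_sets reals.
Import GRing.Theory.
Local Open Scope ring_scope.

(* Write M = A + eps B. The dual index of M is one exactly when M = M^2 N for   *)
(* some N = C + eps D, that is, when A = A^2 C and B = A^2 D + (A B + B A) C.   *)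
(* Let E = A A^#. If such C and D exist, then A C = E, and multiplying the      *)
(* second equation by I - E on both sides kills every term on the right.        *)
(* Conversely C = A^# and D = (A^#)^2 (E B (I - E) - A B A^#) is a solution.    *)

(** The matrix I - E projects onto the kernel of A along its range, so the condition on B says that
    B maps the kernel of A into the range of A. [dual_index_oneP] turns equality of ranges into M =
    M^2 N, and [dual_index_one_dualmxP] splits this into two real equations. *)

Lemma val_dual (R : comNzRingType) (a b : R) :
  val (dualC a + eps * dualC b) = a%:P + b *: 'X.
Proof.
have e : val (eps * dualC b) = b *: 'X.
  rewrite -[LHS]/(polyn _) poly_of_qpolyM -[polyn eps]/(val eps) val_eps.
  rewrite qpolyCE mulrC mul_polyC mk_monic_Xn Pdiv.Ring.rmodp_small //.
  by rewrite size_polyXn (leq_ltn_trans (size_scale_leq _ _)) // size_polyX.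
by rewrite -[LHS]/(polyn _) poly_of_qpolyD -[polyn (eps * _)]/(val _) e qpolyCE.
Qed.

Lemma coef_dual (R : comNzRingType) (a b : R) :
  ((val (dualC a + eps * dualC b))`_0 = a) *
  ((val (dualC a + eps * dualC b))`_1 = b).
Proof.
by rewrite val_dual !coefD !coefC !coefZ !coefX /= mulr0 mulr1 addr0 add0r.
Qed.

Lemma dualE (R : comNzRingType) (x : dual R) :
  x = dualC (val x)`_0 + eps * dualC (val x)`_1.
Proof.
apply: val_inj; rewrite val_dual; apply/polyP=> i.
rewrite coefD coefC coefZ coefX.
case: i => [|[|i]]; rewrite ?mulr0 ?mulr1 ?addr0 ?add0r //=.
(* The representative is reduced modulo ['X^2], so its coefficients vanish from degree 2 on. *)
have := size_mk_monic x; rewrite [in ltnRHS]mk_monic_Xn size_polyXn ltnS => sx.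
by rewrite nth_default // (leq_trans sx).
Qed.

Lemma dualmx_surj (R : comNzRingType) (m n : nat) (M : 'M[dual R]_(m, n)) :
  exists A B : 'M[R]_(m, n), M = dualmx A B.
Proof.
exists (\matrix_(i, j) (val (M i j))`_0), (\matrix_(i, j) (val (M i j))`_1).
by apply/matrixP=> i j; rewrite !mxE -dualE.
Qed.

Lemma dualmx_inj (R : comNzRingType) (m n : nat) (A B C D : 'M[R]_(m, n)) :
  dualmx A B = dualmx C D -> A = C /\ B = D.
Proof.
move=> /matrixP e.
split; apply/matrixP=> i j; have := e i j; rewrite !mxE => /(congr1 val) e'.
  by rewrite -(coef_dual _ (A i j) (B i j)).1 e' coef_dual.
by rewrite -(coef_dual _ (A i j) (B i j)).2 e' coef_dual.
Qed.

Lemma mul_dualmx (R : comNzRingType) (m n p : nat)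
    (A B : 'M[R]_(m, n)) (C D : 'M[R]_(n, p)) :
  dualmx A B *m dualmx C D = dualmx (A *m C) (A *m D + B *m C).
Proof.
(* Writing [dualC] as the ring morphism [qpolyC] makes [map_mxD] and [map_mxM] applicable. *)
pose f := map_mx (qpolyC ('X^2 : {poly R})).
have E k l (U V : 'M[R]_(k, l)) : dualmx U V = f k l U + eps *: f k l V by [].
rewrite !E /f map_mxD !map_mxM mulmxDl !mulmxDr -!scalemxAl -!scalemxAr scalerA.
by rewrite -expr2 eps_sqr scale0r addr0 scalerDr addrA.
Qed.

(** Each column of M lies in the range of M, hence of M^2; the chosen preimages are the columns of
    N. *)
Lemma dual_index_oneP (R : comNzRingType) (n : nat) (M : 'M[dual R]_n) :
  dual_index_one M <-> exists N, M = M *m M *m N.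
Proof.
rewrite /dual_index_one -[M ^+ 2]/(M *m M); split=> [eM|[N eM]].
  have colM j : exists y, col j M = M *m M *m y.
    have : dual_range M (col j M) by exists (delta_mx j 0); rewrite ?colE.
    by rewrite -eM => -[y _ <-]; exists y.
  have [y ey] := choice colM; exists (\matrix_(i, j) y j i 0).
  apply/matrixP=> i j; have /colP/(_ i) := ey j; rewrite !mxE => ->.
  by apply: eq_bigr => k _; rewrite !mxE.
rewrite eqEsubset; split=> _ [y _ <-].
  by exists (M *m y); rewrite ?mulmxA.
by exists (N *m y); rewrite // mulmxA -eM.
Qed.

Lemma dual_index_one_dualmxP (R : comNzRingType) (n : nat) (A B : 'M[R]_n) :
  dual_index_one (dualmx A B) <->
  exists C D, A = A *m A *m C /\ B = A *m A *m D + (A *m B + B *m A) *m C.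
Proof.
rewrite dual_index_oneP; split=> [[N]|[C [D [eA eB]]]].
  have [C [D ->]] := dualmx_surj _ _ _ N.
  by rewrite !mul_dualmx => /dualmx_inj; exists C, D.
by exists (dualmx C D); rewrite !mul_dualmx -eA -eB.
Qed.

Theorem theorem2p5 (R : realType) (n r : nat) (A B : 'M[R]_n)
    (rkA : \rank A = r) :
  dual_index_one (dualmx A B) <->
  (index_one A /\
   (1%:M - A *m group_inverse A) *m B *m (1%:M - A *m group_inverse A) = 0).
Proof.
rewrite dual_index_one_dualmxP; split=> [[C [D [eA eB]]]|[iA]].
  have iA : index_one A.
    apply/eqP; rewrite /index_one expr2 eqn_leq mxrankM_maxl /=.
    by rewrite {1}eA mxrankM_maxl.
  split=> //; have [AXA _ AX] := group_inverseP iA.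
  set X := group_inverse A in AXA AX *; set P := 1%:M - A *m X.
  have PA : P *m A = 0 by rewrite mulmxBl mul1mx AXA subrr.
  have AP : A *m P = 0 by rewrite mulmxBr mulmx1 AX mulmxA AXA subrr.
  (* X A = X A A C = A C, since X A A = A. *)
  have AC : A *m C = A *m X by rewrite AX {2}eA !mulmxA -AX AXA.
  have ACP : A *m C *m P = 0 by rewrite AC AX -mulmxA AP mulmx0.
  (* An opaque P is not itself distributed. Terms starting with A die on the left; B A C dies on the
     right. *)
  clearbody P; rewrite eB mulmxDr mulmxDl mulmxDl mulmxDr !mulmxA PA !mul0mx !add0r.
  by rewrite -!mulmxA (mulmxA A C) ACP !mulmx0.
have [AXA XAX AX] := group_inverseP iA.
set X := group_inverse A in AXA XAX AX *; set P := 1%:M - A *m X => PBP.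
have AAX : A *m A *m X = A by rewrite -mulmxA AX mulmxA.
have AAXX : A *m A *m (X *m X) = A *m X by rewrite mulmxA AAX.
have BP : B *m P = A *m X *m B *m P.
  by apply/eqP; rewrite -subr_eq0 -PBP /P -!mulmxA mulmxBl mul1mx !mulmxA.
(* With C = X, D must satisfy A^2 D = B P - A B X. By [BP] both terms lie in the range of A, where
   A^2 X^2 = A X acts as the identity. *)
exists X, (X *m X *m (A *m X *m B *m P - A *m B *m X)); split=> //.
rewrite mulmxA AAXX mulmxBr !mulmxA AXA mulmxDl addrA addrNK.
by rewrite -BP /P mulmxBr mulmx1 mulmxA addrNK.
Qed.
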